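(* If $A$ and $B$ are semisimple super algebras, then every $A$-$B$-bimodule is implementing.
   Context: Let $k=\mathbb{R}$ or $k=\mathbb{C}$. A super algebra is a finite-dimensional, $\mathbb{Z}_2$-graded, unital, associative $k$-algebra; $\mathrm{Aut}(A)$ denotes the Lie group of even (parity-preserving) algebra automorphisms of $A$. A super algebra $A$ is simple if $1\neq 0$ and $\{0\}$ and $A$ are its only graded two-sided ideals; it is semisimple if it is a (finite) direct sum of simple super algebras. An $A$-$B$-bimodule is a finite-dimensional $\mathbb{Z}_2$-graded $A$-$B$-bimodule over $k$; actions are written $a\triangleright m$, $m\triangleleft b$. For an $A$-$B$-bimodule $M$, $I(M)$ is the group of triples $(\phi,u,\psi)$ with $\phi\in\mathrm{Aut}(A)$, $\psi\in\mathrm{Aut}(B)$ and $u:M\to M$ an even invertible linear map satisfying $u(a\triangleright m\triangleleft b)=\phi(a)\triangleright u(m)\triangleleft\psi(b)$ for all $a,m,b$. It is a closed subgroup of $\mathrm{Aut}(A)\times\mathrm{GL}(M)\times\mathrm{Aut}(B)$, hence a Lie group. $M$ is implementing if both projections $p_\ell:I(M)\to\mathrm{Aut}(A)$ and $p_r:I(M)\to\mathrm{Aut}(B)$ are open maps. *)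

(* Defs.v *)
From HB Require Import structures.
From mathcomp Require Import all_boot all_order all_algebra.
From mathcomp Require Import all_classical all_reals topology normedtype.
From mathcomp Require Import complex.
Set Implicit Arguments.
Unset Strict Implicit.
Unset Printing Implicit Defensive.
Import Order.TTheory GRing.Theory Num.Theory.
Import numFieldNormedType.Exports.

Local Open Scope classical_set_scope.
Local Open Scope ring_scope.

(* The theory is developed over a numFieldType k so that the real and the
   complex case share the same topology, the one given by the norm of k. *)
Inductive real_or_complex (R : realType) : numFieldType -> Prop :=
| RealBase : real_or_complex R R
| ComplexBase : real_or_complex R R[i].

Definition is_grading (k : fieldType) (V : vectType k)
    (g : 'Z_2 -> {vspace V}) : Prop :=
  directv (\sum_(i : 'Z_2) g i) /\ (\sum_(i : 'Z_2) g i)%VS = fullv.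

(* The product is not inherited from algType or falgType, because these exclude
   the zero algebra, which is a super algebra (the empty direct sum). *)
HB.mixin Record isSuperAlgebra (k : fieldType) A of Vector k A := {
  sone : A;
  smul : A -> A -> A;
  smul_linearl : forall b (c : k) (a a' : A),
    smul (c *: a + a') b = c *: smul a b + smul a' b;
  smul_linearr : forall a (c : k) (b b' : A),
    smul a (c *: b + b') = c *: smul a b + smul a b';
  smulA : associative smul;
  smul1l : left_id sone smul;
  smul1r : right_id sone smul;
  grade : 'Z_2 -> {vspace A};
  gradeP : is_grading grade;
  grade1 : sone \in grade 0;
  gradeM : forall (i j : 'Z_2) (a b : A),
    a \in grade i -> b \in grade j -> smul a b \in grade (i + j)
}.

#[short(type="superAlgType")]
HB.structure Definition SuperAlgebra (k : fieldType) :=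
  {A of isSuperAlgebra k A & Vector k A}.

HB.mixin Record isSuperBimodule (k : fieldType) (A B : superAlgType k) M
    of Vector k M := {
  lact : A -> M -> M;
  ract : M -> B -> M;
  lact_linearl : forall m (c : k) (a a' : A),
    lact (c *: a + a') m = c *: lact a m + lact a' m;
  lact_linearr : forall a (c : k) (m m' : M),
    lact a (c *: m + m') = c *: lact a m + lact a m';
  ract_linearl : forall b (c : k) (m m' : M),
    ract (c *: m + m') b = c *: ract m b + ract m' b;
  ract_linearr : forall m (c : k) (b b' : B),
    ract m (c *: b + b') = c *: ract m b + ract m b';
  lact1 : forall m, lact sone m = m;
  ract1 : forall m, ract m sone = m;
  lactM : forall a a' m, lact (smul a a') m = lact a (lact a' m);
  ractM : forall m b b', ract m (smul b b') = ract (ract m b) b';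
  lract : forall a m b, ract (lact a m) b = lact a (ract m b);
  bgrade : 'Z_2 -> {vspace M};
  bgradeP : is_grading bgrade;
  lact_grade : forall (i j : 'Z_2) a m,
    a \in grade i -> m \in bgrade j -> lact a m \in bgrade (i + j);
  ract_grade : forall (i j : 'Z_2) m b,
    m \in bgrade i -> b \in grade j -> ract m b \in bgrade (i + j)
}.

#[short(type="superBimodType")]
HB.structure Definition SuperBimodule (k : fieldType) (A B : superAlgType k) :=
  {M of isSuperBimodule k A B M & Vector k M}.

Section SuperAlgebras.
Context {k : fieldType}.

Definition super_hom (A A' : superAlgType k) (f : 'Hom(A, A')) : Prop :=
  [/\ f sone = sone,
      forall a b, f (smul a b) = smul (f a) (f b) &
      forall (i : 'Z_2) a, a \in grade i -> f a \in grade i].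

Definition super_aut (A : superAlgType k) : set 'End(A) :=
  [set phi | super_hom phi /\ bijective phi].
Arguments super_aut A : clear implicits.

(* An ideal of a unital algebra is a linear subspace; a subspace is graded when
   it is the sum of its homogeneous parts. *)
Definition graded_ideal (A : superAlgType k) (I : {vspace A}) : Prop :=
  [/\ forall a x, x \in I -> smul a x \in I,
      forall x a, x \in I -> smul x a \in I &
      I = (\sum_(i : 'Z_2) (I :&: grade i))%VS].

Definition simple_super (A : superAlgType k) : Prop :=
  (sone : A) <> 0 /\
  forall I : {vspace A}, graded_ideal I -> I = 0%VS \/ I = fullv.

(* The operations and the grading of a direct sum of super algebras are
   componentwise, so an isomorphism from A to the direct sum of the S i is a
   family of super algebra morphisms A -> S i that is jointly bijective. *)
Definition semisimple_super (A : superAlgType k) : Prop :=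
  exists (n : nat) (S : 'I_n -> superAlgType k) (p : forall i, 'Hom(A, S i)),
    [/\ forall i, simple_super (S i),
        forall i, super_hom (p i) &
        bijective (fun a : A => (fun i => p i a) : forall i, S i)].

(* The elements of I(M), as triples ((phi, u), psi). *)
Definition impl_group (A B : superAlgType k) (M : superBimodType A B) :
    set ('End(A) * 'End(M) * 'End(B)) :=
  [set t : 'End(A) * 'End(M) * 'End(B) |
    let phi := t.1.1 in let u := t.1.2 in let psi := t.2 in
    [/\ super_aut A phi, super_aut B psi, bijective u,
        forall (i : 'Z_2) m, m \in bgrade i -> u m \in bgrade i &
        forall a m b,
          u (ract (lact a m) b) = ract (lact (phi a) (u m)) (psi b)]].
Arguments impl_group {A B} M.

Lemma impl_group_autl (A B : superAlgType k) (M : superBimodType A B)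
    (t : set_type (impl_group M)) : (val t).1.1 \in super_aut A.
Proof. by case: t => t /= /set_mem[? ? _ _ _]; apply/mem_set. Qed.

Lemma impl_group_autr (A B : superAlgType k) (M : superBimodType A B)
    (t : set_type (impl_group M)) : (val t).2 \in super_aut B.
Proof. by case: t => t /= /set_mem[? ? _ _ _]; apply/mem_set. Qed.

Definition impl_projl (A B : superAlgType k) (M : superBimodType A B)
    (t : set_type (impl_group M)) : set_type (super_aut A) :=
  SigSub (impl_group_autl t).

Definition impl_projr (A B : superAlgType k) (M : superBimodType A B)
    (t : set_type (impl_group M)) : set_type (super_aut B) :=
  SigSub (impl_group_autr t).

End SuperAlgebras.

Arguments super_aut {k} A _.
Arguments impl_group {k A B} M _.
Arguments impl_projl {k A B} M t.
Arguments impl_projr {k A B} M t.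

(* The usual topology on linear maps between finite-dimensional spaces: that of
   their matrices f2mx in the bases fixed by the vectType structures (it does
   not depend on these bases). *)
HB.instance Definition _ (k : numFieldType) (U V : vectType k) :=
  Topological.copy 'Hom(U, V)
    (initial_topology (@VectorInternalTheory.f2mx k U V)).

Definition open_map (S T : topologicalType) (f : S -> T) : Prop :=
  forall U : set S, open U -> open (f @` U).

(* The automorphism groups and I(M) carry the subspace topologies (the
   canonical topology of set_type). *)
Definition implementing (k : numFieldType) (A B : superAlgType k)
    (M : superBimodType A B) : Prop :=
  open_map (impl_projl M) /\ open_map (impl_projr M).

(* Main.v *)
Require Import Defs.
From HB Require Import structures.
From mathcomp Require Import all_boot all_order all_algebra perm.
From mathcomp Require Import all_classical all_reals topology normedtype.
Set Implicit Arguments.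
Unset Strict Implicit.
Unset Printing Implicit Defensive.
Import Order.TTheory GRing.Theory Num.Theory.
Import numFieldNormedType.Exports.
Import VectorInternalTheory.
Local Open Scope ring_scope.

(** Write t(a,b) = tr(L_(ab)) for the trace form of a super algebra A, where L_a
    is left multiplication by a. The proof has three ingredients.

    - The trace form of a semisimple super algebra in characteristic 0 is
      nondegenerate ([semisimple_trace_radical]). Its radical is a two-sided
      ideal, stable under the parity automorphism because that automorphism
      preserves traces. So the image of the radical in a simple factor is a
      graded ideal, that is, 0 or everything. If it were everything, then the
      radical would contain the unit of that factor, a nonzero idempotent e;
      but t(e,e) = tr(L_e) is the rank of L_e, which is not 0.

    - Let e_i, f_i be dual bases for the trace form. Then sum e_i (x) f_i is a
      separability idempotent: its product sum e_i f_i is 1, and it commutes with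
      A. Hence, for two automorphisms phi, psi of A, the even part X(phi,psi) of
      sum phi(e_i) psi(f_i) satisfies phi(a) X = X psi(a), and X(phi,phi) = 1
      ([exists_intertwiner]). It is linear in phi and in psi, hence continuous.
      This is an explicit form of the fact that automorphisms close to each
      other differ by an even inner automorphism.

    - Given (phi,u,psi) in I(M), the map sending phi' to
      (phi', X(phi',phi) |> u(-), psi) is therefore continuous, takes the value
      (phi,u,psi) at phi, and takes its values in I(M) as soon as its middle
      component is bijective, which holds near phi because the determinant is
      continuous. Such local sections through every point make the left
      projection open ([open_map_local_section]). On the right, the sections are
      psi' |-> (phi, u(-) <| X(psi,psi'), psi'). *)

(** * Traces of endomorphisms *)

Section Trace.
Variable k : fieldType.
Implicit Types U V W : vectType k.

Lemma v2r_lfun V W (f : 'Hom(V, W)) v : v2r (f v) = v2r v *m f2mx f.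
Proof. by rewrite unlock /= r2vK. Qed.

(** The order is reversed because the matrix of a linear map acts on row
    vectors, from the right. *)
Lemma f2mx_comp U V W (f : 'Hom(V, W)) (g : 'Hom(U, V)) :
  f2mx (f \o g)%VF = f2mx g *m f2mx f.
Proof.
apply/row_matrixP=> i; rewrite !rowE mulmxA.
by rewrite -[delta_mx 0 i]r2vK -!v2r_lfun comp_lfunE.
Qed.

Definition lftrace V (f : 'End(V)) : k := \tr (f2mx f).

Lemma lftrace_comp_comm U V (f : 'Hom(U, V)) (g : 'Hom(V, U)) :
  lftrace (f \o g) = lftrace (g \o f).
Proof. by rewrite /lftrace !f2mx_comp mxtrace_mulC. Qed.

Definition stdvec V (i : 'I_(dim V)) : V := r2v (delta_mx 0 i).
Definition stdcoord V (i : 'I_(dim V)) (v : V) : k := v2r v 0 i.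

Lemma stdcoord_linear V i : linear (@stdcoord V i : V -> k^o).
Proof. by move=> c u v; rewrite /stdcoord linearP !mxE. Qed.
HB.instance Definition _ V i :=
  GRing.isLinear.Build k V k^o _ (@stdcoord V i) (@stdcoord_linear V i).

Lemma stdvec_expand V (v : V) : v = \sum_i stdcoord i v *: stdvec i.
Proof.
apply: v2r_inj; rewrite linear_sum [LHS]row_sum_delta.
by apply: eq_bigr => i _; rewrite linearZ /= r2vK.
Qed.

Lemma stdcoord_vec V (i j : 'I_(dim V)) :
  stdcoord i (stdvec j : V) = (i == j)%:R.
Proof. by rewrite /stdcoord r2vK mxE eqxx. Qed.

Lemma lftraceE V (f : 'End(V)) : lftrace f = \sum_i stdcoord i (f (stdvec i)).
Proof.
apply: eq_bigr => i _.
by rewrite /stdcoord v2r_lfun r2vK -rowE mxE.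
Qed.

Lemma lftrace_linear V : linear (@lftrace V : 'End(V) -> k^o).
Proof.
move=> c f g; rewrite !lftraceE scaler_sumr -big_split /=.
by apply: eq_bigr => i _; rewrite add_lfunE scale_lfunE linearP.
Qed.
HB.instance Definition _ V :=
  GRing.isLinear.Build k 'End(V) k^o _ (@lftrace V) (@lftrace_linear V).

(** A rank factorization M = C R of an idempotent matrix satisfies R C = 1, and
    C R and R C have the same trace. *)
Lemma lftrace_idem V (f : 'End(V)) :
  (f \o f)%VF = f -> lftrace f = (\rank (f2mx f))%:R.
Proof.
move=> ff; have := f2mx_comp f f; rewrite ff /lftrace.
move: (f2mx f) => M MM.
suff RC : row_base M *m col_base M = 1%:M.
  by rewrite -{1}(mulmx_base M) mxtrace_mulC RC mxtrace1.
apply: (row_free_inj (row_base_free M)); apply: (row_full_inj (col_base_full M)).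
(* C is left cancellable and R is right cancellable, and C R C R = C R. *)
set C := col_base M; set R := row_base M.
by rewrite mul1mx -(mulmxA R) (mulmxA C) mulmx_base -MM.
Qed.

End Trace.


(** * The parity operator of a graded space *)

Section Parity.
Variable k : numFieldType.
Implicit Types V W : vectType k.

Lemma sum_Z2 V (g : 'Z_2 -> {vspace V}) :
  (\sum_i g i = g 0%R + g 1%R)%VS.
Proof.
rewrite big_ord_recl big_ord1.
by congr (g _ + g _)%VS; apply: val_inj.
Qed.

Lemma eq_oppv V (v : V) : v = - v -> v = 0.
Proof.
move=> /eqP; rewrite -addr_eq0 -mulr2n -scaler_nat scaler_eq0 pnatr_eq0 /=.
by move/eqP.
Qed.

Lemma half_double V (v : V) : 2^-1 *: (v + v) = v.
Proof. by rewrite -mulr2n -(scaler_nat 2 v) scalerA mulVf ?scale1r ?pnatr_eq0. Qed.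

(** The operator that is 1 on even vectors and -1 on odd vectors. Stability under
    it is what it means for a subspace to be graded, and commutation with it is
    what it means for a linear map to be even; both are then plain identities
    between linear maps. *)
Definition parity V (g : 'Z_2 -> {vspace V}) : 'End(V) :=
  daddv_pi (g 0) (g 1) - daddv_pi (g 1) (g 0).

Section Grading.
Variables (V : vectType k) (g : 'Z_2 -> {vspace V}).
Hypothesis gP : is_grading g.
Local Notation s := (parity g).

Let g01 : (g 0%R :&: g 1%R = 0)%VS.
Proof.
have [/directv_sumP/(_ 0 isT) dxg _] := gP.
by move: dxg; rewrite big_mkcond sum_Z2 /= add0v.
Qed.

Lemma grading_split v :
  exists v0 v1, [/\ v0 \in g 0, v1 \in g 1, v = v0 + v1 & s v = v0 - v1].
Proof.
have [_] := gP; rewrite sum_Z2 => sumg.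
exists (daddv_pi (g 0) (g 1) v), (daddv_pi (g 1) (g 0) v).
split; rewrite ?memv_pi ?add_lfunE ?opp_lfunE // daddv_pi_add //.
by rewrite sumg memvf.
Qed.

Lemma parity_even v : v \in g 0 <-> s v = v.
Proof.
split=> [v0|].
  rewrite add_lfunE opp_lfunE daddv_pi_id // -[X in _ - X]addr0.
  have := daddv_pi_add g01 (subvP (addvSl _ _) _ v0).
  rewrite daddv_pi_id // => /(canRL (addKr _)) ->.
  by rewrite addNr addr0 subr0.
have [v0 [v1 [g0 g1 -> ->]]] := grading_split v.
by move=> /addrI/esym/eq_oppv ->; rewrite addr0.
Qed.

Lemma parity_odd v : v \in g 1 <-> s v = - v.
Proof.
have g10 : (g 1%R :&: g 0%R = 0)%VS by rewrite capvC.
split=> [v1|].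
  rewrite add_lfunE opp_lfunE (daddv_pi_id g10) //.
  have := daddv_pi_add g10 (subvP (addvSl _ _) _ v1).
  rewrite daddv_pi_id // => /(canRL (addKr _)) ->.
  by rewrite addNr add0r.
have [v0 [v1 [g0 g1 -> ->]]] := grading_split v.
by rewrite opprD => /addIr/eq_oppv ->; rewrite add0r.
Qed.

Lemma parityK v : s (s v) = v.
Proof.
have [v0 [v1 [/parity_even e0 /parity_odd e1 -> ->]]] := grading_split v.
by rewrite linearB /= e0 e1 opprK.
Qed.

Lemma even_part v : 2^-1 *: (v + s v) \in g 0.
Proof. by apply/parity_even; rewrite linearZ linearD /= parityK addrC. Qed.

Lemma odd_part v : 2^-1 *: (v - s v) \in g 1.
Proof.
by apply/parity_odd; rewrite linearZ linearB /= parityK -scalerN opprB.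
Qed.

Lemma parity_stable_graded (I : {vspace V}) :
  (forall v, v \in I -> s v \in I) -> I = (\sum_i (I :&: g i))%VS.
Proof.
move=> sI; apply/eqP; rewrite eqEsubv; apply/andP; split; last first.
  by apply/subv_sumP => i _; apply: capvSl.
apply/subvP=> v Iv; rewrite (sum_Z2 (fun i => (I :&: g i)%VS)).
have -> : v = 2^-1 *: (v + s v) + 2^-1 *: (v - s v).
  by rewrite -scalerDr addrACA subrr addr0 half_double.
by apply: memv_add; rewrite memv_cap ?even_part ?odd_part andbT memvZ;
  rewrite ?memvB ?memvD ?sI.
Qed.

End Grading.

Lemma parity_morph V W (g : 'Z_2 -> {vspace V}) (h : 'Z_2 -> {vspace W})
    (f : 'Hom(V, W)) : is_grading g -> is_grading h ->
  (forall i v, v \in g i -> f v \in h i) ->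
  forall v, f (parity g v) = parity h (f v).
Proof.
move=> gP hP fgh v; have [v0 [v1 [g0 g1 -> ->]]] := grading_split gP v.
rewrite linearB linearD linearD /=.
have /(parity_even hP) -> := fgh _ _ g0.
by have /(parity_odd hP) -> := fgh _ _ g1.
Qed.

End Parity.

(** * The trace form of a super algebra *)

Section Superalgebra.
Variable k : numFieldType.
Implicit Types A B : superAlgType k.

HB.instance Definition _ A (a : A) :=
  GRing.isLinear.Build k A A _ (smul a) (smul_linearr a).

Definition lmul A (a : A) : 'End(A) := linfun (smul a).

Lemma lmulE A (a b : A) : lmul a b = smul a b. Proof. exact: lfunE. Qed.

Definition rsmul A (b a : A) : A := smul a b.
HB.instance Definition _ A (b : A) :=
  GRing.isLinear.Build k A A _ (rsmul b) (smul_linearl b).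

Definition grade_parity A : 'End(A) := parity (@grade k A).

Lemma smul_suml A I (r : seq I) (F : I -> A) b :
  smul (\sum_(i <- r) F i) b = \sum_(i <- r) smul (F i) b.
Proof. exact: (linear_sum (rsmul b)). Qed.

Lemma smul_sumr A I (r : seq I) (F : I -> A) a :
  smul a (\sum_(i <- r) F i) = \sum_(i <- r) smul a (F i).
Proof. exact: linear_sum. Qed.

Lemma smulDl A (a a' b : A) : smul (a + a') b = smul a b + smul a' b.
Proof. exact: (linearD (rsmul b)). Qed.

Lemma smulBl A (a a' b : A) : smul (a - a') b = smul a b - smul a' b.
Proof. exact: (linearB (rsmul b)). Qed.

Lemma smulZl A c (a b : A) : smul (c *: a) b = c *: smul a b.
Proof. by rewrite -[LHS]/(rsmul b _) linearZ. Qed.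

Lemma grade_parityM A (a b : A) :
  grade_parity A (smul a b) = smul (grade_parity A a) (grade_parity A b).
Proof.
have gA := @gradeP k A; rewrite /grade_parity.
have [a0 [a1 [ga0 ga1 -> ->]]] := grading_split gA a.
have [b0 [b1 [gb0 gb1 -> ->]]] := grading_split gA b.
have Z2 : 1 + 1 = 0 :> 'Z_2 by apply: val_inj.
have := gradeM _ _ _ _ ga0 gb0; rewrite addr0 => /(parity_even gA) e00.
have := gradeM _ _ _ _ ga0 gb1; rewrite add0r => /(parity_odd gA) e01.
have := gradeM _ _ _ _ ga1 gb0; rewrite addr0 => /(parity_odd gA) e10.
have := gradeM _ _ _ _ ga1 gb1; rewrite Z2 => /(parity_even gA) e11.
rewrite smulDl smulBl !linearD /= !linearN /= e00 e01 e10 e11.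
by rewrite opprK.
Qed.

Lemma grade_parityK A (a : A) : grade_parity A (grade_parity A a) = a.
Proof. exact: (parityK (@gradeP k A)). Qed.

Lemma super_hom_parity A B (f : 'Hom(A, B)) (a : A) : super_hom f ->
  f (grade_parity A a) = grade_parity B (f a).
Proof. by case=> _ _ fg; rewrite [LHS](parity_morph gradeP gradeP fg). Qed.

(** The trace of the regular representation. *)
Definition algtrace A (a : A) : k := lftrace (lmul a).

Lemma algtrace_linear A : linear (@algtrace A : A -> k^o).
Proof.
move=> c a b; rewrite /algtrace -linearP; congr lftrace.
by apply/lfunP=> x; rewrite add_lfunE scale_lfunE !lmulE smulDl smulZl.
Qed.
HB.instance Definition _ A :=
  GRing.isLinear.Build k A k^o _ (@algtrace A) (@algtrace_linear A).

Lemma lmulM A (a b : A) : lmul (smul a b) = (lmul a \o lmul b)%VF.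
Proof. by apply/lfunP=> x; rewrite comp_lfunE !lmulE smulA. Qed.

Lemma algtraceC A (a b : A) : algtrace (smul a b) = algtrace (smul b a).
Proof. by rewrite /algtrace !lmulM lftrace_comp_comm. Qed.

(** The parity operator s is an involutive automorphism of A, so that left
    multiplication by s(a) is the conjugate of left multiplication by a. *)
Lemma algtrace_parity A (a : A) : algtrace (grade_parity A a) = algtrace a.
Proof.
rewrite /algtrace; set s := grade_parity A.
have -> : lmul (s a) = (s \o (lmul a \o s))%VF.
  by apply/lfunP=> x; rewrite !comp_lfunE !lmulE grade_parityM grade_parityK.
rewrite lftrace_comp_comm -comp_lfunA; congr lftrace.
by apply/lfunP=> x; rewrite !comp_lfunE grade_parityK.
Qed.

(** Left multiplication by e is a nonzero idempotent, so its trace is a positive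
    integer, which is not 0 in characteristic 0. *)
Lemma algtrace_idem_neq0 A (e : A) : smul e e = e -> e != 0 -> algtrace e != 0.
Proof.
move=> ee; apply: contraNneq.
have /lftrace_idem : (lmul e \o lmul e)%VF = lmul e by rewrite -lmulM ee.
rewrite /algtrace => -> /eqP; rewrite pnatr_eq0 mxrank_eq0 => /eqP le0.
apply/eqP/v2r_inj; rewrite linear0 -{1}[e]smul1r -lmulE v2r_lfun le0.
by rewrite mulmx0.
Qed.

(** The map from A to its dual given by the trace form; the dual is identified
    with A by means of the standard basis. *)
Definition trace_gram A (b : A) : A :=
  \sum_i algtrace (smul (stdvec i) b) *: stdvec i.

Lemma trace_gram_linear A : linear (@trace_gram A).
Proof.
move=> c a b; rewrite /trace_gram scaler_sumr -big_split /=.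
apply: eq_bigr => i _; rewrite linearP /=.
by rewrite [algtrace _](linearP (@algtrace A)) scalerDl scalerA.
Qed.
HB.instance Definition _ A :=
  GRing.isLinear.Build k A A _ (@trace_gram A) (@trace_gram_linear A).

Definition trace_map A : 'End(A) := linfun (@trace_gram A).

Lemma stdcoord_trace_map A i (b : A) :
  stdcoord i (trace_map A b) = algtrace (smul (stdvec i) b).
Proof.
rewrite lfunE /= linear_sum (bigD1 i) //= big1 ?addr0 => [|j ji].
  by rewrite linearZ /= stdcoord_vec eqxx [_ *: _]mulr1.
by rewrite linearZ /= stdcoord_vec eq_sym (negPf ji) scaler0.
Qed.

Definition trace_radical A : {vspace A} := lker (trace_map A).

Lemma trace_radicalP A (b : A) :
  reflect (forall a, algtrace (smul a b) = 0) (b \in trace_radical A).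
Proof.
rewrite memv_ker; apply: (iffP eqP) => [Tb a | tb].
  rewrite [a]stdvec_expand smul_suml [LHS]linear_sum big1 // => i _.
  by rewrite smulZl [LHS]linearZ /= -stdcoord_trace_map Tb linear0 scaler0.
rewrite [LHS]stdvec_expand big1 // => i _.
by rewrite stdcoord_trace_map tb scale0r.
Qed.

Lemma trace_radical_mull A (a x : A) :
  x \in trace_radical A -> smul a x \in trace_radical A.
Proof.
by move/trace_radicalP=> xN; apply/trace_radicalP=> c; rewrite smulA xN.
Qed.

Lemma trace_radical_mulr A (x a : A) :
  x \in trace_radical A -> smul x a \in trace_radical A.
Proof.
move/trace_radicalP=> xN; apply/trace_radicalP=> c.
by rewrite smulA algtraceC smulA xN.
Qed.

Lemma trace_radical_parity A (x : A) :
  x \in trace_radical A -> grade_parity A x \in trace_radical A.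
Proof.
move/trace_radicalP=> xN; apply/trace_radicalP=> c.
by rewrite -(grade_parityK c) -grade_parityM algtrace_parity xN.
Qed.

(** Stability under parity is preserved by even maps, and surjectivity makes the
    image absorb products with all elements of B. *)
Lemma image_graded_ideal A B (p : 'Hom(A, B)) (I : {vspace A}) :
  super_hom p -> (forall b, exists a, p a = b) ->
  (forall a x, x \in I -> smul a x \in I) ->
  (forall x a, x \in I -> smul x a \in I) ->
  (forall x, x \in I -> grade_parity A x \in I) ->
  graded_ideal (p @: I)%VS.
Proof.
move=> hp ps Il Ir Is; have [_ pM _] := hp.
split=> [b _ /memv_imgP[x Ix ->]|_ b /memv_imgP[x Ix ->]|].
- by have [a <-] := ps b; rewrite -pM memv_img // Il.
- by have [a <-] := ps b; rewrite -pM memv_img // Ir.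
apply: parity_stable_graded => [|_ /memv_imgP[x Ix ->]]; first exact: gradeP.
by rewrite -[parity _ _](super_hom_parity _ hp) memv_img // Is.
Qed.

(** The image of the radical in a simple factor is a graded ideal, hence 0 or the
    whole factor. The second case is impossible: the radical would contain the
    central idempotent e of that factor, but e pairs to a nonzero number with
    itself. *)
Lemma semisimple_trace_radical A : semisimple_super A -> trace_radical A = 0%VS.
Proof.
case=> n [S [p [simS hp [g pK gK]]]].
have pinj a : (forall i, p i a = 0) -> a = 0.
  move=> pa; rewrite -(pK a) -(pK 0); congr g.
  by apply: functional_extensionality_dep => i; rewrite pa linear0.
have psurj (h : forall i, S i) : exists a, forall i, p i a = h i.
  by exists (g h) => i; rewrite -[in RHS](gK h).
have pone i (b : S i) : exists a, p i a = b /\ forall j, j != i -> p j a = 0.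
  have [a pa] := psurj (@dfwith _ S (fun j => 0) i b).
  by exists a; rewrite pa dfwithin; split=> // j ji; rewrite pa dfwithout // eq_sym.
apply/eqP; rewrite -subv0; apply/subvP=> x Nx; rewrite memv0; apply/eqP.
apply: (pinj) => i; apply/eqP; rewrite -memv0; have [S1 simSi] := simS i.
suff <- : (p i @: trace_radical A)%VS = 0%VS by rewrite memv_img.
have [] := simSi (p i @: trace_radical A)%VS.
- apply: image_graded_ideal => //.
  + by move=> b; have [a []] := pone _ b; exists a.
  + exact: trace_radical_mull.
  + exact: trace_radical_mulr.
  + exact: trace_radical_parity.
- by [].
move=> full; exfalso.
have /memv_imgP[y Ny py] : sone \in (p i @: trace_radical A)%VS.
  by rewrite full memvf.
(* y is an element of the radical with component 1 in the factor S i, and e is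
   the unit of that factor, so that y e = e lies in the radical. *)
have [e [pe pe0]] := pone _ (sone : S i).
have pM j := let: And3 _ h _ := hp j in h.
have ye : smul y e = e.
  apply/eqP; rewrite -subr_eq0; apply/eqP/pinj => j.
  rewrite linearB /= pM; have [->|ji] := eqVneq j i.
    by rewrite pe -py smul1l subrr.
  by rewrite pe0 // linear0 subrr.
have ee : smul e e = e.
  apply/eqP; rewrite -subr_eq0; apply/eqP/pinj => j.
  rewrite linearB /= pM; have [->|ji] := eqVneq j i.
    by rewrite pe smul1l subrr.
  by rewrite pe0 // linear0 subrr.
have e0 : e != 0 by apply/eqP => e0; apply: S1; rewrite -pe e0 linear0.
have /trace_radicalP/(_ e) := trace_radical_mulr e Ny.
by rewrite ye ee; apply/eqP/algtrace_idem_neq0.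
Qed.

(** The last identity says that the Casimir element of the trace form multiplies
    to 1. This is where the regular trace is needed: pairing a with the sum of
    the e_i f_i gives the sum of the i-th coordinates of a e_i, that is, tr(L_a),
    which is also the pairing of a with 1. *)
Lemma dual_basis A : trace_radical A = 0%VS ->
  exists f : 'I_(dim A) -> A,
    [/\ forall i a, algtrace (smul a (f i)) = stdcoord i a,
        forall b, b = \sum_i algtrace (smul (stdvec i) b) *: f i &
        \sum_i smul (stdvec i) (f i) = sone].
Proof.
move=> N0; have /eqP kT : trace_radical A = 0%VS by [].
have Tinj := lker0P kT.
pose f i := (trace_map A)^-1%VF (stdvec i); exists f.
have Tf i : trace_map A (f i) = stdvec i by apply: lker0_lfunVK.
have tf i a : algtrace (smul a (f i)) = stdcoord i a.
  rewrite [a in LHS]stdvec_expand smul_suml [LHS]linear_sum.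
  rewrite (bigD1 i) //= big1 ?addr0 => [|j ji].
    by rewrite smulZl [LHS]linearZ /= -stdcoord_trace_map Tf stdcoord_vec eqxx
      [LHS]mulr1.
  by rewrite smulZl [LHS]linearZ /= -stdcoord_trace_map Tf stdcoord_vec
    (negPf ji) [LHS]mulr0.
split=> // [b|].
  apply: Tinj; rewrite linear_sum [LHS]stdvec_expand; apply: eq_bigr => i _.
  by rewrite linearZ /= Tf stdcoord_trace_map.
apply/eqP; rewrite -subr_eq0 -memv0 -N0; apply/trace_radicalP => a.
rewrite linearB /= [LHS]linearB /= smul1r smul_sumr [X in X - _]linear_sum.
apply/eqP; rewrite subr_eq0; apply/eqP.
rewrite [RHS]lftraceE; apply: eq_bigr => i _.
by rewrite /= smulA tf lmulE.
Qed.

(** The intertwiner is the even part of the sum of the phi(e_i) psi(f_i). That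
    sum intertwines because the Casimir element of an invariant form commutes
    with A: expanding a e_i in the basis e and f_j a in the basis f yields the
    same coefficients, by t(a e_i, f_j) = t(e_i, f_j a). The even part still
    intertwines since phi and psi commute with the parity operator. *)
Lemma exists_intertwiner A : semisimple_super A ->
  exists X : 'End(A) -> 'End(A) -> A,
    [/\ forall psi, linear (X^~ psi),
        forall phi, linear (X phi),
        forall phi, super_hom phi -> X phi phi = sone,
        forall phi psi, super_hom phi -> super_hom psi ->
          X phi psi \in grade 0 &
        forall phi psi a, super_hom phi -> super_hom psi ->
          smul (phi a) (X phi psi) = smul (X phi psi) (psi a)].
Proof.
move=> /semisimple_trace_radical/dual_basis[f [tf f_expand f1]].
pose Y (phi psi : 'End(A)) := \sum_i smul (phi (stdvec i)) (psi (f i)).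
have Ytw phi psi a : super_hom phi -> super_hom psi ->
    smul (phi a) (Y phi psi) = smul (Y phi psi) (psi a).
  move=> [_ phiM _] [_ psiM _]; rewrite smul_sumr smul_suml.
  under eq_bigr => i _.
    rewrite smulA -phiM [smul a _]stdvec_expand linear_sum smul_suml; over.
  rewrite exchange_big /=; apply: eq_bigr => j _.
  rewrite -smulA -psiM [X in psi X]f_expand linear_sum smul_sumr.
  apply: eq_bigr => i _.
  rewrite linearZ smulZl linearZ [in RHS]linearZ /=; congr (_ *: _).
  by rewrite -tf -smulA algtraceC smulA.
pose s := grade_parity A.
exists (fun phi psi => 2^-1 *: (Y phi psi + s (Y phi psi))); split.
- move=> psi c u v; have -> : Y (c *: u + v) psi = c *: Y u psi + Y v psi.
    rewrite /Y scaler_sumr -big_split; apply: eq_bigr => i _ /=.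
    by rewrite add_lfunE scale_lfunE smulDl smulZl.
  rewrite linearP scalerA mulrC -scalerA -scalerDr; congr (_ *: _).
  by rewrite scalerDr addrACA.
- move=> phi c u v; have -> : Y phi (c *: u + v) = c *: Y phi u + Y phi v.
    rewrite /Y scaler_sumr -big_split; apply: eq_bigr => i _ /=.
    by rewrite add_lfunE scale_lfunE linearP.
  rewrite linearP scalerA mulrC -scalerA -scalerDr; congr (_ *: _).
  by rewrite scalerDr addrACA.
- move=> phi [phi1 phiM _].
  have -> : Y phi phi = sone.
    rewrite -phi1 -f1 linear_sum; apply: eq_bigr => i _; exact/esym/phiM.
  have /(parity_even (@gradeP k A)) -> := @grade1 k A.
  exact: half_double.
- by move=> phi psi _ _; apply: even_part; apply: gradeP.
move=> phi psi a hphi hpsi; rewrite linearZ /= smulZl; congr (_ *: _).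
rewrite linearD smulDl /= Ytw //; congr (_ + _).
have := congr1 s (Ytw phi psi (s a) hphi hpsi).
rewrite !grade_parityM -(super_hom_parity _ hphi) -(super_hom_parity _ hpsi).
by rewrite grade_parityK.
Qed.

End Superalgebra.

(** * The topology on spaces of linear maps *)

Section HomTopology.
Local Open Scope classical_set_scope.
Variable k : numFieldType.
Implicit Types U V W : vectType k.

Lemma f2mxE V W (f : 'Hom(V, W)) i j :
  f2mx f i j = stdcoord j (f (stdvec i)).
Proof. by rewrite /stdcoord v2r_lfun r2vK -rowE mxE. Qed.

Lemma f2mx_linear V W : linear (@f2mx k V W).
Proof.
move=> c f g; apply/matrixP => i j.
by rewrite !mxE !f2mxE add_lfunE scale_lfunE linearP.
Qed.
HB.instance Definition _ V W :=
  GRing.isLinear.Build k 'Hom(V, W) 'M_(_, _) _ (@f2mx k V W) (@f2mx_linear V W).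

Lemma lfun_sum_delta V W (f : 'Hom(V, W)) :
  f = \sum_i \sum_j f2mx f i j *: Hom (delta_mx i j).
Proof.
apply: val_inj; rewrite /= [LHS]matrix_sum_delta linear_sum.
apply: eq_bigr => i _; rewrite linear_sum; apply: eq_bigr => j _.
by rewrite linearZ.
Qed.

Lemma continuous_f2mx V W : continuous (@f2mx k V W).
Proof. exact: initial_continuous. Qed.

Lemma continuous_to_Hom (T : topologicalType) V W (F : T -> 'Hom(V, W)) :
  (forall i j, continuous (fun t => f2mx (F t) i j)) -> continuous F.
Proof.
move=> cF; suff cM : continuous (fun t => f2mx (F t)).
  apply/continuousP => _ [B oB <-].
  by rewrite -[X in open X]/((fun t => f2mx (F t)) @^-1` B);
    apply: open_comp => // t _; apply: cM.
move=> t A [P nP sPA].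
suff : \forall s \near t, forall i j, P i j (f2mx (F s) i j).
  by apply: filterS => s Ps; apply: sPA.
apply: filter_forall => i; apply: filter_forall => j.
exact: cF (nP i j).
Qed.

Lemma continuous_sum (T : topologicalType) (I : finType) (F : I -> T -> k) :
  (forall i, continuous (F i)) -> continuous (fun t => \sum_i F i t).
Proof. by move=> cF; apply: continuous_big => //; exact: add_continuous. Qed.

Lemma continuous_prod (T : topologicalType) (I : finType) (F : I -> T -> k) :
  (forall i, continuous (F i)) -> continuous (fun t => \prod_i F i t).
Proof. by move=> cF; apply: continuous_big => //; exact: mul_continuous. Qed.

(** The entries of the matrix of F f are linear combinations of those of f. *)
Lemma linear_continuous_Hom V W V' W' (F : 'Hom(V, W) -> 'Hom(V', W')) :
  linear F -> continuous F.
Proof.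
move=> linF.
pose G : {linear 'Hom(V, W) -> 'Hom(V', W')} :=
  HB.pack F (GRing.isLinear.Build k 'Hom(V, W) 'Hom(V', W') *:%R F linF).
apply: continuous_to_Hom => i' j'.
have -> : (fun f => f2mx (F f) i' j') = fun f =>
    \sum_i \sum_j f2mx f i j * f2mx (F (Hom (delta_mx i j))) i' j'.
  apply/funext => f.
  have -> : F f = \sum_i \sum_j f2mx f i j *: F (Hom (delta_mx i j)).
    rewrite [in LHS](lfun_sum_delta f) [LHS](linear_sum G).
    apply: eq_bigr => i _; rewrite [LHS](linear_sum G).
    by apply: eq_bigr => j _; apply: (linearZ_LR G).
  rewrite linear_sum summxE; apply: eq_bigr => i _.
  rewrite linear_sum summxE; apply: eq_bigr => j _.
  by rewrite linearZ mxE.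
apply: continuous_sum => i; apply: continuous_sum => j f.
apply: continuousM; last exact: cst_continuous.
apply: (@continuous_comp _ _ _ (@f2mx k V W) (fun M => M i j)).
  exact: continuous_f2mx.
exact: coord_continuous.
Qed.

Lemma continuous_det n : continuous (fun M : 'M[k]_n => \det M).
Proof.
apply: continuous_sum => s M.
apply: (@continuousM _ _ (fun=> (-1) ^+ s)); first exact: cst_continuous.
by apply: (continuous_prod (F := fun i (N : 'M[k]_n) => N i (s i))) => i;
  exact: coord_continuous.
Qed.

Lemma f2mx1 V : f2mx (\1%VF : 'End(V)) = 1%:M.
Proof.
apply/row_matrixP=> i.
by rewrite !rowE mulmx1 -[delta_mx 0 i]r2vK -v2r_lfun id_lfunE.
Qed.

Lemma bijective_unitmx V (u : 'End(V)) : bijective u <-> f2mx u \in unitmx.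
Proof.
split=> [[v uK vK]|uU].
  have u0 : lker u == 0%VS by apply/lker0P; apply: can_inj uK.
  by have := f2mx_comp u^-1 u; rewrite lker0_compVf // f2mx1 => /esym/mulmx1_unit[].
exists (fun w => r2v (v2r w *m invmx (f2mx u))) => w.
  by rewrite v2r_lfun mulmxK ?v2rK.
by apply: v2r_inj; rewrite v2r_lfun r2vK mulmxKV.
Qed.

(** Bijectivity is the nonvanishing of the determinant, which is continuous. *)
Lemma near_bijective V (u : 'End(V)) :
  bijective u -> \forall v \near u, bijective (v : 'End(V)).
Proof.
move=> /bijective_unitmx; rewrite unitmxE unitfE => du.
have cd : (\det (f2mx v) @[v --> u] --> \det (f2mx u)).
  apply: (@continuous_comp _ _ _ (@f2mx k V V) (fun M => \det M)).
    exact: continuous_f2mx.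
  exact: continuous_det.
apply: filterS (cvgr_neq0 _ cd du) => v dv.
by apply/bijective_unitmx; rewrite unitmxE unitfE.
Qed.

End HomTopology.

Local Open Scope classical_set_scope.

(** A map between subspaces is open if through every point of its source there is
    a continuous local section. The section F is defined on the whole ambient
    space, but only its values at points of Y near q x are required to lie in X. *)
Lemma open_map_local_section (S T : topologicalType) (X : set S) (Y : set T)
    (f : set_type X -> set_type Y) (q : S -> T) :
  (forall x, val (f x) = q (val x)) ->
  (forall x, X x -> exists F : T -> S,
    [/\ continuous F, F (q x) = x &
     \forall y \near q x, Y y -> X (F y) /\ q (F y) = y]) ->
  open_map f.
Proof.
move=> fq sec U [V oV VU]; rewrite openE => _ [x Ux <-].
have [|F [cF Fqx Fnear]] := sec (val x); first by apply: set_valP.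
have qxE : q (val x) = val (f x) by rewrite fq.
have Vnear : \forall y \near q (val x), V (F y).
  apply: cF; rewrite Fqx; apply: open_nbhs_nbhs; split=> //.
  by have : (val @^-1` V) x by rewrite VU.
have near_qx : \forall y \near val (f x),
    V (F y) /\ (Y y -> X (F y) /\ q (F y) = y).
  by rewrite -qxE; apply: filterI.
have near_fx : \forall y \near f x,
    V (F (val y)) /\ (Y (val y) -> X (F (val y)) /\ q (F (val y)) = val y).
  exact: (@initial_continuous _ _ (@set_val _ Y) (f x) _ near_qx).
rewrite /interior /=; near=> y.
have [Vy Fy] : V (F (val y)) /\
    (Y (val y) -> X (F (val y)) /\ q (F (val y)) = val y).
  by near: y.
have [XFy qFy] := Fy (set_valP y).
exists (SigSub (mem_set XFy) : set_type X); last first.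
  by apply: val_inj; rewrite fq.
by rewrite -VU.
Unshelve. all: by end_near.
Qed.

(** * Lifting automorphisms to bimodules *)

Section Bimodule.
Variables (k : numFieldType) (A B : superAlgType k) (M : superBimodType A B).

HB.instance Definition _ (a : A) :=
  GRing.isLinear.Build k M M _ (@lact k A B M a) (lact_linearr a).

Definition ractr (b : B) (m : M) : M := ract m b.
HB.instance Definition _ (b : B) :=
  GRing.isLinear.Build k M M _ (ractr b) (ract_linearl b).

Definition lact_lfun (a : A) : 'End(M) := linfun (@lact k A B M a).
Definition ract_lfun (b : B) : 'End(M) := linfun (ractr b).

Lemma lact_lfunE a m : lact_lfun a m = lact a m.
Proof. exact: lfunE. Qed.

Lemma ract_lfunE b m : ract_lfun b m = ract m b.
Proof. exact: lfunE. Qed.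

Lemma lact_lfun1 : lact_lfun sone = \1%VF.
Proof. by apply/lfunP=> m; rewrite lact_lfunE lact1 id_lfunE. Qed.

Lemma ract_lfun1 : ract_lfun sone = \1%VF.
Proof. by apply/lfunP=> m; rewrite ract_lfunE ract1 id_lfunE. Qed.

(** Composing u with the action of an intertwiner x changes the automorphism
    phi of A to phi', because phi'(a) x = x phi(a). Evenness of x keeps u even. *)
Lemma impl_group_lact phi phi' u psi (x : A) :
  impl_group M (phi, u, psi) -> super_aut A phi' -> x \in grade 0 ->
  (forall a, smul (phi' a) x = smul x (phi a)) ->
  bijective (lact_lfun x \o u)%VF ->
  impl_group M (phi', (lact_lfun x \o u)%VF, psi).
Proof.
move=> [/= _ hpsi _ ug uM] hphi' x0 xtw bij; split=> //= [i m mi|a m b].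
  rewrite comp_lfunE lact_lfunE -[i]add0r.
  by apply: lact_grade => //; apply: ug.
by rewrite !comp_lfunE !lact_lfunE uM -lract -!lactM xtw.
Qed.

Lemma impl_group_ract phi u psi psi' (y : B) :
  impl_group M (phi, u, psi) -> super_aut B psi' -> y \in grade 0 ->
  (forall b, smul (psi b) y = smul y (psi' b)) ->
  bijective (ract_lfun y \o u)%VF ->
  impl_group M (phi, (ract_lfun y \o u)%VF, psi').
Proof.
move=> [/= hphi _ _ ug uM] hpsi' y0 ytw bij; split=> //= [i m mi|a m b].
  rewrite comp_lfunE ract_lfunE -[i]addr0.
  by apply: ract_grade => //; apply: ug.
by rewrite !comp_lfunE !ract_lfunE uM -ractM ytw ractM lract.
Qed.

Lemma continuous_pair3 (T : topologicalType) (S1 S2 S3 : topologicalType)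
  (f : T -> S1) (g : T -> S2) (h : T -> S3) :
  continuous f -> continuous g -> continuous h ->
  continuous (fun t => (f t, g t, h t)).
Proof.
by move=> cf cg ch t; exact: (cvg_pair (cvg_pair (cf t) (cg t)) (ch t)).
Qed.

(** The local section through (phi,u,psi) sends phi' to (phi', x |> u(-), psi),
    where x is the intertwiner of phi' and phi. *)
Lemma open_impl_projl : semisimple_super A -> open_map (impl_projl M).
Proof.
move=> /exists_intertwiner[X [Xlin _ X1 X0 Xtw]].
apply: (@open_map_local_section _ _ _ _ _ (fun t => t.1.1)) => //.
move=> [[phi u] psi] t_impl /=; have [/= [hphi _] _ ubij _ _] := t_impl.
pose U phi' := (lact_lfun (X phi' phi) \o u)%VF.
have cU : continuous U.
  apply: linear_continuous_Hom => c f g; apply/lfunP => m.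
  rewrite add_lfunE scale_lfunE !comp_lfunE !lact_lfunE.
  by rewrite [X in lact X](Xlin phi) lact_linearl.
have Uphi : U phi = u by rewrite /U X1 // lact_lfun1 comp_lfun1l.
exists (fun phi' => (phi', U phi', psi)); split.
- apply: continuous_pair3; [|exact: cU|exact: cst_continuous].
  by move=> ?; exact: cvg_id.
- by rewrite Uphi.
have Ubij : \forall phi' \near phi, bijective (U phi').
  have bij : bijective (U phi) by rewrite Uphi.
  exact: (cU phi _ (near_bijective bij)).
near=> phi' => hphi'; split=> //; have [hom' _] := hphi'.
have bij : bijective (U phi') by near: phi'.
apply: impl_group_lact t_impl hphi' _ _ bij; first exact: X0.
by move=> a; apply: Xtw.
Unshelve. all: by end_near.
Qed.

(** The intertwiner y acts on the right of M, so it has to satisfy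
    psi(b) y = y psi'(b): the automorphism that varies is now on the right. *)
Lemma open_impl_projr : semisimple_super B -> open_map (impl_projr M).
Proof.
move=> /exists_intertwiner[X [_ Xlin X1 X0 Xtw]].
apply: (@open_map_local_section _ _ _ _ _ (fun t => t.2)) => //.
move=> [[phi u] psi] t_impl /=; have [/= _ [hpsi _] ubij _ _] := t_impl.
pose U psi' := (ract_lfun (X psi psi') \o u)%VF.
have cU : continuous U.
  apply: linear_continuous_Hom => c f g; apply/lfunP => m.
  rewrite add_lfunE scale_lfunE !comp_lfunE !ract_lfunE.
  by rewrite [X in ract _ X](Xlin psi) ract_linearr.
have Upsi : U psi = u by rewrite /U X1 // ract_lfun1 comp_lfun1l.
exists (fun psi' => (phi, U psi', psi')); split.
- apply: continuous_pair3; [exact: cst_continuous|exact: cU|].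
  by move=> ?; exact: cvg_id.
- by rewrite Upsi.
have Ubij : \forall psi' \near psi, bijective (U psi').
  have bij : bijective (U psi) by rewrite Upsi.
  exact: (cU psi _ (near_bijective bij)).
near=> psi' => hpsi'; split=> //; have [hom' _] := hpsi'.
have bij : bijective (U psi') by near: psi'.
apply: impl_group_ract t_impl hpsi' _ _ bij; first exact: X0.
by move=> b; apply: Xtw.
Unshelve. all: by end_near.
Qed.

End Bimodule.

Theorem corollary3p1p12 (R : realType) (k : numFieldType)
    (hk : real_or_complex R k) (A B : superAlgType k)
    (hA : semisimple_super A) (hB : semisimple_super B)
    (M : superBimodType A B) :
  implementing M.
Proof. by split; [apply: open_impl_projl | apply: open_impl_projr]. Qed.
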